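(* Let $\varphi\in L^1_{\mathrm{loc}}(\mathbb{R}_+)$. Then $Q_\varphi$ has finite rank if and only if $\varphi$ is a step function. In this case, the rank of $Q_\varphi$ equals the number of steps of $\varphi$.
   Context: $\mathbb{R}_+=(0,\infty)$, and ''loc'' refers to compact subsets of $(0,\infty)$. For a locally integrable complex-valued function $\varphi$ on $\mathbb{R}_+$, the operator $Q_\varphi$ is defined on bounded functions $f$ with compact support in $\mathbb{R}_+$ by $(Q_\varphi f)(x)=\int_0^\infty\varphi(\max\{x,y\})f(y)\,dy$; ''$Q_\varphi$ has finite rank'' means that it extends to a bounded operator of finite rank on $L^2(\mathbb{R}_+)$. $\varphi$ is a step function if there exist finitely many numbers $0=x_0<x_1<\dots<x_N<\infty$ (with $N\ge0$) such that $\varphi$ is a.e. constant on each interval $(x_{i-1},x_i)$, $1\le i\le N$, and a.e. zero on $(x_N,\infty)$. The number of steps of $\varphi$ is the smallest possible $N$ in this definition. *)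

(* Defs.v *)
From HB Require Import structures.
From mathcomp Require Import all_boot all_order all_algebra.
From mathcomp Require Import complex.
From mathcomp Require Import all_classical all_reals all_analysis.
From mathcomp Require Import measurable_realfun.
From mathcomp Require Import ring lra.

Set Implicit Arguments.
Unset Strict Implicit.
Unset Printing Implicit Defensive.

Import Order.TTheory GRing.Theory Num.Theory.
Import numFieldNormedType.Exports.

Local Open Scope classical_set_scope.
Local Open Scope ring_scope.

Notation Re := (@complex.Re _).
Notation Im := (@complex.Im _).
Notation normc := ComplexField.Normc.normc.

(* Functions are total on R; only their values on halfline = (0, +oo) matter,
   every notion below being restricted to it. *)
Section ComplexIntegration.
Variable R : realType.
Local Notation mu := (@lebesgue_measure R).

Definition halfline : set R := `]0, +oo[.

Definition cmeasurable_fun (D : set R) (f : R -> R[i]) : Prop :=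
  measurable_fun D (Re \o f) /\ measurable_fun D (Im \o f).

Definition cintegral (D : set R) (f : R -> R[i]) : R[i] :=
  Complex (\int[mu]_(y in D) Re (f y)) (\int[mu]_(y in D) Im (f y)).

Definition clocally_integrable (f : R -> R[i]) : Prop :=
  cmeasurable_fun halfline f /\
  forall K : set R, K `<=` halfline -> compact K ->
    (\int[mu]_(x in K) (normc (f x))%:E < +oo)%E.

Definition ae_eq_halfline (f g : R -> R[i]) : Prop :=
  {ae mu, forall x, halfline x -> f x = g x}.

End ComplexIntegration.

Section L2.
Variable R : realType.
Local Notation mu := (@lebesgue_measure R).
Local Notation D := (@halfline R).

Definition square_integrable (f : R -> R[i]) : Prop :=
  cmeasurable_fun D f /\ (\int[mu]_(x in D) (normc (f x) ^+ 2)%:E < +oo)%E.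

Definition L2pred : {pred R -> R[i]} := [pred f | `[< square_integrable f >]].

Lemma ReD (a b : R[i]) : Re (a + b) = Re a + Re b.
Proof. by case: a b => [? ?] []. Qed.
Lemma ImD (a b : R[i]) : Im (a + b) = Im a + Im b.
Proof. by case: a b => [? ?] []. Qed.
Lemma ReM (a b : R[i]) : Re (a * b) = Re a * Re b - Im a * Im b.
Proof. by case: a b => [? ?] []. Qed.
Lemma ImM (a b : R[i]) : Im (a * b) = Re a * Im b + Im a * Re b.
Proof. by case: a b => [? ?] []. Qed.

Lemma normc_sqr (a : R[i]) : normc a ^+ 2 = Re a ^+ 2 + Im a ^+ 2.
Proof. by case: a => x y /=; rewrite sqr_sqrtr// addr_ge0// sqr_ge0. Qed.

Lemma measurable_normc_sqr (A : set R) (f : R -> R[i]) :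
  cmeasurable_fun A f -> measurable_fun A (fun x => normc (f x) ^+ 2).
Proof.
move=> [mr mi].
apply: (eq_measurable_fun (fun x => (Re (f x)) ^+ 2 + (Im (f x)) ^+ 2)).
  by move=> x _; rewrite normc_sqr.
by apply: measurable_funD; apply: measurable_funX.
Qed.

Lemma cmeasurable_funDZ (A : set R) (c : R[i]) (f g : R -> R[i]) :
  cmeasurable_fun A f -> cmeasurable_fun A g ->
  cmeasurable_fun A (c *: f + g).
Proof.
move=> [fr fi] [gr gi]; split.
- apply: (eq_measurable_fun
    (fun x => Re c * Re (f x) - Im c * Im (f x) + Re (g x))).
    by move=> x _ /=; rewrite ReD ReM.
  apply: measurable_funD => //; apply: measurable_funB => //;
    exact: measurable_funM.
- apply: (eq_measurable_fun
    (fun x => Re c * Im (f x) + Im c * Re (f x) + Im (g x))).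
    by move=> x _ /=; rewrite ImD ImM.
  apply: measurable_funD => //; apply: measurable_funD => //;
    exact: measurable_funM.
Qed.

Lemma L2pred_submod_closed : submod_closed L2pred.
Proof.
have mD : measurable D by exact: measurable_itv.
split.
  apply/asboolP; split; first by split; exact: measurable_cst.
  rewrite (eq_integral (cst 0%E)) ?integral0//.
  by move=> x _; rewrite normc_sqr /= expr0n /= addr0.
move=> c f g /asboolP[mf If] /asboolP[mg Ig]; apply/asboolP.
have mfg := cmeasurable_funDZ c mf mg.
split=> //.
pose k := 2 * normc c ^+ 2.
have k0 : 0 <= k by rewrite /k mulr_ge0// sqr_ge0.
have mEf : measurable_fun D (fun x => (normc (f x) ^+ 2)%:E).
  by apply/measurable_EFinP; exact: measurable_normc_sqr.
have mEg : measurable_fun D (fun x => (normc (g x) ^+ 2)%:E).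
  by apply/measurable_EFinP; exact: measurable_normc_sqr.
apply: (@le_lt_trans _ _ (\int[mu]_(x in D)
   (k%:E * (normc (f x) ^+ 2)%:E + 2%:E * (normc (g x) ^+ 2)%:E))%E).
  apply: ge0_le_integral => //.
  - by move=> x _; rewrite lee_fin sqr_ge0.
  - by apply/measurable_EFinP; exact: measurable_normc_sqr.
  - by apply: emeasurable_funD; exact: measurable_funeM.
  - move=> x _; rewrite -!EFinM -EFinD lee_fin /k !normc_sqr ReD ImD ReM ImM.
    set a := Re c; set b := Im c; set u := Re (f x); set v := Im (f x).
    set p := Re (g x); set q := Im (g x).
    have := sqr_ge0 (a * u - b * v - p); have := sqr_ge0 (a * v + b * u - q).
    nra.
rewrite ge0_integralD//; last 4 first.
- by move=> x _; rewrite -EFinM lee_fin mulr_ge0// sqr_ge0.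
- exact: measurable_funeM.
- by move=> x _; rewrite -EFinM lee_fin mulr_ge0// sqr_ge0.
- exact: measurable_funeM.
rewrite !ge0_integralZl//; try by move=> x _; rewrite lee_fin sqr_ge0.
by rewrite lte_add_pinfty// lte_mul_pinfty.
Qed.

HB.instance Definition _ :=
  GRing.isSubmodClosed.Build R[i] (R -> R[i]) L2pred L2pred_submod_closed.

Definition L2fun : Type := {f : R -> R[i] | f \in L2pred}.
HB.instance Definition _ := Choice.on L2fun.
HB.instance Definition _ := SubChoice.on L2fun.
HB.instance Definition _ := [SubChoice_isSubLmodule of L2fun by <:].

Definition L2fun_fun (f : L2fun) : R -> R[i] := val f.
Coercion L2fun_fun : L2fun >-> Funclass.

Definition L2null : {pred L2fun} := [pred f : L2fun | `[< ae_eq_halfline f 0 >]].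

Lemma L2null_submod_closed : submod_closed L2null.
Proof.
split; first by apply/asboolP; apply: aeW.
move=> c f g /asboolP f0 /asboolP g0; apply/asboolP.
move: f0 g0; apply: (@filterS2 _ _ (ae_filter_ringOfSetsType mu)) => x f0 g0 Dx.
have -> : (c *: f + g : L2fun) x = c * (f : L2fun) x + (g : L2fun) x by [].

by rewrite (f0 Dx) (g0 Dx) mulr0 addr0.
Qed.

HB.instance Definition _ :=
  GRing.isSubmodClosed.Build R[i] L2fun L2null L2null_submod_closed.

Local Open Scope quotient_scope.

(* L^2(R_+; C) as a vector space over R[i], modulo a.e. equality. *)
Definition L2 : Type := Quotient.quot L2null.
HB.instance Definition _ := GRing.Zmodule.on L2.
HB.instance Definition _ := EqQuotient.on L2.

Definition L2class (f : L2fun) : L2 := \pi_L2 f.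
Definition L2_fun (u : L2) : R -> R[i] := (repr u : L2fun).
Coercion L2_fun : L2 >-> Funclass.

Lemma L2classP (f g : L2fun) : L2class f = L2class g <-> ae_eq_halfline f g.
Proof.
have E x : (f - g : L2fun) x = (f : L2fun) x - (g : L2fun) x by [].
rewrite (rwP eqP) [_ == _]piE /= -[X in X <-> _]/(is_true (f - g \in L2null)).
rewrite -(rwP (asboolP _)); split.
all: apply: (@filterS _ _ (ae_filter_ringOfSetsType mu)) => x h Dx.
  by apply/eqP; rewrite -subr_eq0 -E h.
by rewrite E h// subrr.
Qed.

Lemma L2_funK (u : L2) : L2class (repr u) = u.
Proof. exact: reprK. Qed.

Definition L2scale (c : R[i]) (u : L2) : L2 := L2class (c *: (repr u : L2fun)).

Lemma L2class_is_zmod_morphism : zmod_morphism L2class.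
Proof. by move=> f g; rewrite /L2class !piE. Qed.

HB.instance Definition _ :=
  GRing.isZmodMorphism.Build L2fun L2 L2class L2class_is_zmod_morphism.

Lemma L2class_scale c (f : L2fun) : L2class (c *: f) = L2scale c (L2class f).
Proof.
apply/L2classP.
have : ae_eq_halfline (repr (L2class f) : L2fun) f by apply/L2classP/L2_funK.
apply: (@filterS _ _ (ae_filter_ringOfSetsType mu)) => x h Dx.
have E (g : L2fun) : (c *: g : L2fun) x = c * g x by [].
by rewrite !E h.
Qed.

Lemma L2scaleA a b u : L2scale a (L2scale b u) = L2scale (a * b) u.
Proof. by rewrite -[u]L2_funK -!L2class_scale scalerA. Qed.
Lemma L2scale1 : left_id 1 L2scale.
Proof. by move=> u; rewrite -[u]L2_funK -!L2class_scale scale1r. Qed.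
Lemma L2scaleDr : right_distributive L2scale +%R.
Proof.
move=> a u v; rewrite -[u]L2_funK -[v]L2_funK -raddfD -!L2class_scale.
by rewrite scalerDr raddfD.
Qed.
Lemma L2scaleDl u : {morph L2scale^~ u : a b / a + b}.
Proof. by move=> a b; rewrite -[u]L2_funK -!L2class_scale scalerDl raddfD. Qed.

HB.instance Definition _ := GRing.Zmodule_isLmodule.Build R[i] L2
  L2scaleA L2scale1 L2scaleDr L2scaleDl.

Lemma L2class_is_scalable : scalable L2class.
Proof. by move=> c f; exact: L2class_scale. Qed.

HB.instance Definition _ :=
  GRing.isScalable.Build R[i] L2fun L2 *:%R L2class L2class_is_scalable.

Definition L2norm (u : L2) : R :=
  Num.sqrt (\int[mu]_(x in D) (normc (u x) ^+ 2)).

Definition bounded_operator (T : L2 -> L2) : Prop :=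
  exists C : R, forall u : L2, L2norm (T u) <= C * L2norm u.

End L2.

Section Rank.
Variables (K : fieldType) (V W : lmodType K).

(* n is the dimension of the range: e is a basis of it. *)
Definition has_rank (T : V -> W) (n : nat) : Prop :=
  exists e : 'I_n -> W,
    (forall c : 'I_n -> K, \sum_i c i *: e i = 0 -> forall i, c i = 0) /\
    range T = [set \sum_i c i *: e i | c in [set: 'I_n -> K]].

End Rank.

Section Q.
Variable R : realType.
Local Notation mu := (@lebesgue_measure R).
Local Notation D := (@halfline R).

(* Only used for phi locally integrable and f bounded, measurable and compactly
   supported, where the integrand is integrable for every x in halfline. *)
Definition Qop (phi f : R -> R[i]) (x : R) : R[i] :=
  cintegral D (fun y => phi (Num.max x y) * f y).

Definition bounded_compactly_supported (f : R -> R[i]) : Prop :=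
  (exists M : R, forall x, D x -> normc (f x) <= M) /\
  (exists K : set R, [/\ K `<=` D, compact K &
     forall x, D x -> ~ K x -> f x = 0]).

(* Every measurable bounded compactly supported function is in L2fun, so f ranges
   over the whole initial domain of Q_phi. *)
Definition bounded_extension (phi : R -> R[i])
    (T : {linear L2 R -> L2 R}) : Prop :=
  bounded_operator T /\
  forall f : L2fun R, bounded_compactly_supported f ->
    ae_eq_halfline (T (L2class f) : L2 R) (Qop phi f).

(* The extension is unique, bounded functions with compact support being dense
   in L2, so "the rank of Q_phi" is unambiguous. *)
Definition Q_has_rank (phi : R -> R[i]) (n : nat) : Prop :=
  exists T : {linear L2 R -> L2 R}, bounded_extension phi T /\ has_rank T n.

Definition Q_finite_rank (phi : R -> R[i]) : Prop :=
  exists n, Q_has_rank phi n.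

(* Of the sequence x, only the points x 0 < ... < x N are relevant. *)
Definition step_partition (phi : R -> R[i]) (N : nat) : Prop :=
  exists x : nat -> R,
    [/\ x 0%N = 0,
        forall i, (i < N)%N -> x i < x i.+1,
        forall i, (i < N)%N -> exists c : R[i],
          {ae mu, forall t, x i < t < x i.+1 -> phi t = c} &
        {ae mu, forall t, x N < t -> phi t = 0}].

Definition step_function (phi : R -> R[i]) : Prop :=
  exists N, step_partition phi N.

Definition number_of_steps (phi : R -> R[i]) (N : nat) : Prop :=
  step_partition phi N /\ forall M, step_partition phi M -> (N <= M)%N.

End Q.

(* Main.v *)
From Pilot Require Import Defs.
From mathcomp Require Import all_boot all_order all_algebra.
From mathcomp Require Import complex.
From mathcomp Require Import all_classical all_reals all_analysis.
From mathcomp Require Import measurable_realfun.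
From mathcomp Require Import ring lra.
From HB Require Import structures.

Set Implicit Arguments.
Unset Strict Implicit.
Unset Printing Implicit Defensive.

Import Order.TTheory GRing.Theory Num.Theory.
Import numFieldNormedType.Exports.
Import Pilot.Defs.

Local Open Scope classical_set_scope.
Local Open Scope ring_scope.

(** The proof rests on two inequalities and on the uniqueness of the extension.

    Upper bound. Take a partition with [N] pieces, and let [b_1 < ... < b_N] be
    its positive breakpoints. Then [phi] is a.e. a combination
    [sum_i d_i 1_(0, b_i)] of [N] indicators, and the indicator of [(0, b)]
    takes the product value [1(x) * 1(y)] at [max(x, y)].  Hence [Q_phi] is the
    separable operator [f |-> sum_i d_i <f, 1_(0, b_i)> 1_(0, b_i)], which is
    bounded on L^2 by Cauchy-Schwarz and has rank at most [N]
    ([Q_rank_le_of_step]).  That the rank reaches the minimal number of steps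
    is then a consequence of the lower bound.

    Lower bound. For [0 < p < q], the image of the indicator of [[p, q]] is
    constant on [(0, p)] and equals [(q - p) phi] on [(q, oo)]
    ([extension_indic]).  Suppose that there are [m] intervals [(q_i, r_i)],
    listed from left to right with [r_i < q_(i+1)], on none of which [phi] is
    a.e. constant.  Choose [p_i] between [r_(i-1)] and [q_i].  On the first
    interval the image of the first indicator is a nonzero multiple of [phi],
    while the images of all the others are constant; so its coefficient in a
    linear relation vanishes, and so do the others one after the other
    ([oscillates_indep]).  Therefore [m] is at most the rank [n].
    Conversely, a function with no [n + 1] such intervals is a.e. constant on
    the pieces of a partition with at most [n] breakpoints
    ([partition_of_oscillates]).  On the unbounded last piece the constant is
    zero, because the image of an indicator placed there is a.e. a multiple of
    that constant near infinity and is square integrable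
    ([ae_cst_on_ray_eq0]).  This gives a step partition with at most [n]
    pieces ([step_le_rank]).

    Uniqueness. Truncations of [f] are bounded with compact support and
    converge to [f] in L^2, so two bounded extensions agree and the rank is a
    well defined number ([Q_has_rank_uniq]).  With this the two inequalities
    identify the rank with the smallest number of pieces. *)

(** * Ranks and linear independence *)

Section FiniteRank.
Context {K : fieldType} {V W : lmodType K}.

Definition lin_indep n (w : 'I_n -> W) : Prop :=
  forall c : 'I_n -> K, \sum_i c i *: w i = 0 -> forall i, c i = 0.

Definition in_span n (e : 'I_n -> W) (v : W) : Prop :=
  exists c : 'I_n -> K, v = \sum_i c i *: e i.

(** The coefficients of the [w k] along the [e i] form an [m] by [n] matrix; if
    [n < m] it has a nonzero row vector in its kernel, which is a linear
    relation between the [w k]. *)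
Lemma indep_le_span m n (e : 'I_n -> W) (w : 'I_m -> W) :
  (forall k, in_span e (w k)) -> lin_indep w -> (m <= n)%N.
Proof.
move=> /choice[c wE] w_indep; rewrite leqNgt; apply/negP => nm.
pose M : 'M[K]_(m, n) := \matrix_(k, i) c k i.
have : kermx M != 0.
  rewrite -mxrank_eq0 mxrank_ker -lt0n subn_gt0.
  exact: leq_ltn_trans (rank_leq_col M) nm.
move=> /rowV0Pn[v /sub_kermxP vM0 /negP]; apply.
apply/eqP/rowP => k; rewrite mxE; apply: (w_indep (v 0)).
under eq_bigr do rewrite wE scaler_sumr.
rewrite exchange_big big1// => i _.
transitivity ((v *m M) 0 i *: e i); last by rewrite vM0 mxE scale0r.
by rewrite mxE scaler_suml; apply: eq_bigr => k' _; rewrite scalerA mxE.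
Qed.

Definition fcons n (v : W) (w : 'I_n -> W) (i : 'I_n.+1) : W :=
  if unlift ord0 i is Some j then w j else v.

(** The second premise is what a triangular argument provides: the coefficient
    of the new vector vanishes in every relation. *)
Lemma lin_indep_fcons n (v : W) (w : 'I_n -> W) : lin_indep w ->
  (forall (a : K) (c : 'I_n -> K), a *: v + \sum_i c i *: w i = 0 -> a = 0) ->
  lin_indep (fcons v w).
Proof.
move=> w_indep v_indep c; rewrite big_ord_recl /fcons unlift_none.
under eq_bigr do rewrite liftK.
move=> c0; have a0 := v_indep _ _ c0.
move: c0; rewrite a0 scale0r add0r => /w_indep cw i.
by case: (unliftP ord0 i) => [j ->|->//]; exact: cw.
Qed.

Lemma has_rank_indep n (T : V -> W) : has_rank T n ->
  exists2 w : 'I_n -> W, lin_indep w & forall i, range T (w i).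
Proof.
move=> [e [e_indep eT]]; exists e => // i; rewrite eT.
exists (fun j => (j == i)%:R) => //.
rewrite (bigD1 i)//= eqxx scale1r big1 ?addr0// => j /negPf ->.
by rewrite scale0r.
Qed.

Lemma has_rank_span n (T : V -> W) : has_rank T n ->
  exists e : 'I_n -> W, forall u, in_span e (T u).
Proof.
move=> [e [_ eT]]; exists e => u.
have : range T (T u) by exists u.
by rewrite eT => -[c _ <-]; exists c.
Qed.

Lemma has_rank_uniq m n (T : V -> W) : has_rank T m -> has_rank T n -> m = n.
Proof.
suff le p q : has_rank T p -> has_rank T q -> (p <= q)%N.
  by move=> hm hn; apply/eqP; rewrite eqn_leq !le.
move=> /has_rank_indep[w w_indep wT] /has_rank_span[e eT].
by apply: indep_le_span w_indep => k; have [u _ <-] := wT k.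
Qed.

(** Take a largest family of vectors with independent images: these images form
    a basis of the range, since the image of any further vector would otherwise
    extend the family. *)
Lemma has_rank_of_span N (T : {linear V -> W}) (e : 'I_N -> W) :
  (forall u, in_span e (T u)) -> exists2 n, (n <= N)%N & has_rank T n.
Proof.
move=> Te.
pose P n := `[< exists u : 'I_n -> V, lin_indep (T \o u) >].
have P0 : exists n, P n.
  by exists 0; apply/asboolP; exists (fun=> 0) => c _ [].
have P_le n : P n -> (n <= N)%N.
  by move=> /asboolP[u]; apply: indep_le_span => k; exact: Te.
case: (ex_maxnP P0 P_le) => n Pn n_max.
exists n; first exact: P_le.
have /asboolP[u u_indep] := Pn; exists (T \o u); split => //.
apply/seteqP; split => w.
  move=> [v _ <-{w}]; apply: contrapT => v_span.
  have /n_max : P n.+1; last by rewrite ltnn.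
  apply/asboolP; exists (fun i => if unlift ord0 i is Some j then u j else v).
  have -> : T \o (fun i => if unlift ord0 i is Some j then u j else v) =
            fcons (T v) (T \o u).
    by apply/funext => i; rewrite /fcons /=; case: (unlift ord0 i).
  apply: lin_indep_fcons => // a c /eqP; rewrite addr_eq0 => /eqP aTv.
  apply: contrapT => /eqP a0; apply: v_span.
  exists (fun i => - (a^-1 * c i)) => //.
  rewrite -[RHS]scale1r -(mulVf a0) -scalerA aTv scalerN scaler_sumr -sumrN.
  by apply: eq_bigr => i _; rewrite scaleNr scalerA.
move=> [c _ <-{w}]; exists (\sum_i c i *: u i) => //.
by rewrite linear_sum; apply: eq_bigr => i _; rewrite linearZ.
Qed.

End FiniteRank.

(** * Functions that are constant almost everywhere on an interval *)

(** Stated for the filter in the form in which it occurs in [{ae mu, _}], so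
    that [filterS] and its variants find it. *)
#[local] Instance ae_lebesgue_filter (R : realType) :
    Filter (nbhs (almost_everywhere (@lebesgue_measure R))) :=
  ae_filter_ringOfSetsType (@lebesgue_measure R).

Section AlmostEverywhereConstant.
Context {R : realType}.
Local Notation mu := (@lebesgue_measure R).
Implicit Types (phi : R -> R[i]) (a b q r : R).

Lemma ae_itv_point a b (P : R -> Prop) : a < b ->
  {ae mu, forall t, P t} -> exists2 t, a < t < b & P t.
Proof.
move=> ab aeP; apply: contrapT => noP.
have : mu.-negligible `]a, b[%classic.
  apply: negligibleS aeP => t /=; rewrite in_itv /= => tab Pt.
  by apply: noP; exists t.
move=> negl; have : mu `]a, b[%classic = 0%E.
  by apply: measure_negligible negl; exact: measurable_itv.
rewrite lebesgue_measure_itv /= lte_fin ab -EFinD => -[] /eqP.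
by rewrite subr_eq0 gt_eqF.
Qed.

Definition ae_cst_on phi (A : set R) : Prop :=
  exists c, {ae mu, forall t, A t -> phi t = c}.

Lemma ae_cst_on_subset phi (A B : set R) : A `<=` B ->
  ae_cst_on phi B -> ae_cst_on phi A.
Proof.
by move=> AB [c phic]; exists c; apply: filterS phic => t phic /AB /phic.
Qed.

(** The sets share an interval of positive measure, which forces all their
    constants to agree; the union is countable, so the exceptional sets add up
    to a negligible one. *)
Lemma ae_cst_on_bigcup phi (A : nat -> set R) a b : a < b ->
  (forall n t, a < t < b -> A n t) -> (forall n, ae_cst_on phi (A n)) ->
  ae_cst_on phi (\bigcup_n A n).
Proof.
move=> ab abA /choice[c phic]; exists (c 0%N).
have cE n : c n = c 0%N.
  have /(ae_itv_point ab)[t tab [phin phi0]] :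
    {ae mu, forall t, (A n t -> phi t = c n) /\ (A 0%N t -> phi t = c 0%N)}.
    by apply: filterS2 (phic n) (phic 0%N) => t.
  by rewrite -phin ?phi0//; exact: abA.
have /ae_foralln := phic; apply: filterS => t phit [n _ /phit ->].
exact: cE.
Qed.

Lemma ae_cst_on_itv phi a b :
  (forall q r, a < q -> q < r -> r < b ->
     ae_cst_on phi [set t | q < t < r]) ->
  ae_cst_on phi [set t | a < t < b].
Proof.
move=> phi_in; have [ba|ab] := leP b a.
  by exists 0; apply: aeW => t /= /andP[/lt_trans h /h]; rewrite ltNge ba.
(* Exhaust the interval from inside by intervals that all contain its middle
   third. *)
pose h n : R := (b - a) / 3 / n.+1%:R.
have h0 n : 0 < h n by rewrite /h !divr_gt0 ?subr_gt0.
have h3 n : h n <= (b - a) / 3.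
  by rewrite ler_pdivrMr// ler_peMr ?ler1n// divr_ge0// subr_ge0 ltW.
pose A n := [set t | a + h n < t < b - h n].
apply: (@ae_cst_on_subset _ _ (\bigcup_n A n)); last first.
  apply: (@ae_cst_on_bigcup _ _ (a + (b - a) / 3) (b - (b - a) / 3)).
  - lra.
  - by move=> n t /= /andP[? ?]; apply/andP; split; have := h3 n; lra.
  - by move=> n; have := h3 n; have := h0 n => ? ?; apply: phi_in; lra.
move=> t /= /andP[at_ tb].
have [n nE] : exists n : nat, (b - a) / 3 * ((t - a)^-1 + (b - t)^-1) < n.+1%:R.
  exists (Num.truncn ((b - a) / 3 * ((t - a)^-1 + (b - t)^-1))).
  exact: truncnS_gt.
have ta0 : 0 < (t - a)^-1 by rewrite invr_gt0 subr_gt0.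
have bt0 : 0 < (b - t)^-1 by rewrite invr_gt0 subr_gt0.
have hk d : 0 < d -> (b - a) / 3 * d^-1 < n.+1%:R -> h n < d.
  by move=> d0; rewrite /h !ltr_pdivrMr// (mulrC d).
have sum_le d d' : 0 < d' ->
    (b - a) / 3 * d <= (b - a) / 3 * (d + d').
  by move=> /ltW d'0; rewrite ler_wpM2l ?lerDl// divr_ge0// subr_ge0 ltW.
have hta : h n < t - a.
  by rewrite hk ?subr_gt0//; apply: le_lt_trans (sum_le _ _ bt0) nE.
have hbt : h n < b - t.
  rewrite hk ?subr_gt0//; apply: le_lt_trans (sum_le _ _ ta0) _.
  by rewrite (addrC _^-1).
by exists n => //; apply/andP; split; lra.
Qed.

Lemma ae_cst_on_ray phi a :
  (forall q r, a < q -> q < r -> ae_cst_on phi [set t | q < t < r]) ->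
  ae_cst_on phi [set t | a < t].
Proof.
move=> phi_in; pose A n := [set t | a < t < a + n.+1%:R].
apply: (@ae_cst_on_subset _ _ (\bigcup_n A n)).
  move=> t /= at_; exists (Num.truncn (t - a)) => //=.
  by apply/andP; split; rewrite // -ltrBlDl truncnS_gt.
apply: (@ae_cst_on_bigcup _ _ a (a + 1)); first by rewrite ltrDl.
  move=> n t /= /andP[at_ /lt_le_trans tb]; apply/andP; split=> //; apply: tb.
  by rewrite lerD2l ler1n.
by move=> n; apply: ae_cst_on_itv => q r aq qr _; exact: phi_in.
Qed.

(** [oscillates phi m a] produces [m] intervals beyond [a], each strictly to
    the right of the preceding one, on none of which [phi] is a.e. constant.
    The strict gaps leave room for an indicator to the left of each interval. *)
Fixpoint oscillates phi m a : Prop :=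
  if m is m'.+1 then
    exists q r, [/\ a < q, q < r, ~ ae_cst_on phi [set t | q < t < r] &
                    oscillates phi m' r]
  else True.

(** The first breakpoint is the infimum [s] of the right ends of the intervals
    beyond [a] on which [phi] is not a.e. constant. Before [s] the function is
    constant. Any such interval whose left end exceeds [s] has another one
    entirely before it, so the family counted beyond [s] is shorter by one and
    induction applies there. When [s = a] no breakpoint is added. *)
Lemma partition_of_oscillates phi N a : ~ oscillates phi N.+1 a ->
  exists M x, [/\ (M <= N)%N, x 0%N = a,
    forall i, (i < M)%N -> x i < x i.+1,
    forall i, (i < M)%N -> ae_cst_on phi [set t | x i < t < x i.+1] &
    ae_cst_on phi [set t | x M < t]].
Proof.
elim: N a => [|N IHN] a no_osc.
  exists 0%N, (fun=> a); split=> //; apply: ae_cst_on_ray => q r aq qr.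
  by apply: contrapT => bad; apply: no_osc; exists q, r.
pose E := [set r | exists q, [/\ a < q, q < r &
  ~ ae_cst_on phi [set t | q < t < r]]].
have [E0|/set0P E0] := eqVneq E set0.
  exists 0%N, (fun=> a); split=> //; apply: ae_cst_on_ray => q r aq qr.
  apply: contrapT => bad; suff : E r by rewrite E0.
  by exists q.
have E_lb : lbound E a by move=> r [q [aq /(lt_trans aq)/ltW]].
set s := inf E.
have a_s : a <= s by exact: lb_le_inf.
have /IHN[M [x [MN x0 x_lt x_cst x_last]]] : ~ oscillates phi N.+1 s.
  move=> [q [r [sq qr bad osc]]]; apply: no_osc.
  have [r' [q' [aq' qr' bad']] r'q] := inf_lt E0 sq.
  by exists q', r'; split=> //; exists q, r.
have [sa|a_neq_s] := eqVneq a s.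
  by exists M, x; rewrite sa; split => //; exact: leqW.
exists M.+1, (fun i => if i is j.+1 then x j else a); split => //.
- by case=> [|i] iM; [rewrite x0 lt_neqAle a_neq_s|exact: x_lt].
- case=> [_|i iM]; last exact: x_cst.
  rewrite x0; apply: ae_cst_on_itv => q r aq qr rs.
  apply: contrapT => bad; have : s <= r; last by rewrite leNgt rs.
  by apply: ge_inf; [exists a|exists q].
Qed.

End AlmostEverywhereConstant.

(** * The space of square integrable functions *)

Lemma measurable_halfline (R : realType) : measurable (@halfline R).
Proof. exact: measurable_itv. Qed.

#[local] Hint Extern 0 (measurable (@halfline _)) =>
  exact: measurable_halfline : core.

Lemma halflineE (R : realType) (x : R) : halfline x = (0 < x) :> Prop.
Proof. by rewrite /halfline /= in_itv /= andbT. Qed.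

Section L2Space.
Context {R : realType}.
Local Notation mu := (@lebesgue_measure R).
Local Notation D := (@halfline R).
Implicit Types (f g : L2fun R) (u v : L2 R).

(** The squared L^2 norm, kept in the extended reals so that no finiteness has
    to be shown before integrals are compared. *)
Definition sqn (f : R -> R[i]) : \bar R :=
  (\int[mu]_(x in D) (normc (f x) ^+ 2)%:E)%E.

Lemma L2fun_square_integrable f : square_integrable f.
Proof. exact/asboolP/(valP f). Qed.

Definition mkL2fun (f : R -> R[i]) (h : square_integrable f) : L2fun R :=
  exist _ f (asboolT h).

Lemma sqn_ge0 (f : R -> R[i]) : (0 <= sqn f)%E.
Proof. by apply: integral_ge0 => x _; rewrite lee_fin sqr_ge0. Qed.

Lemma sqn_fin_num f : sqn f \is a fin_num.
Proof. by rewrite ge0_fin_numE ?sqn_ge0//; case: (L2fun_square_integrable f). Qed.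

Lemma measurable_normc_sqr_fun f :
  measurable_fun D (fun x => (normc (f x) ^+ 2)%:E).
Proof.
apply/measurable_EFinP; apply: measurable_normc_sqr.
by case: (L2fun_square_integrable f).
Qed.

Lemma ae_eq_sqn f g : ae_eq_halfline f g -> sqn f = sqn g.
Proof.
move=> fg; apply: ge0_ae_eq_integral => //.
- exact: measurable_normc_sqr_fun.
- exact: measurable_normc_sqr_fun.
- by move=> x _; rewrite lee_fin sqr_ge0.
- by move=> x _; rewrite lee_fin sqr_ge0.
- by apply: filterS fg => x fg Dx; rewrite fg.
Qed.

Lemma sqnD f g : (sqn (f + g : L2fun R)%R <= 2%:E * (sqn f + sqn g))%E.
Proof.
have mf := measurable_normc_sqr_fun f; have mg := measurable_normc_sqr_fun g.
rewrite /sqn -ge0_integralD//; try by move=> x _; rewrite lee_fin sqr_ge0.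
rewrite -ge0_integralZl//; last 2 first.
- exact: emeasurable_funD.
- by move=> x _; rewrite -EFinD lee_fin addr_ge0 ?sqr_ge0.
apply: ge0_le_integral => //.
- by move=> x _; rewrite lee_fin sqr_ge0.
- exact: (measurable_normc_sqr_fun (f + g : L2fun R)).
- by apply: measurable_funeM; exact: emeasurable_funD.
- move=> x _; rewrite -EFinD -EFinM lee_fin !normc_sqr ReD ImD.
  have := sqr_ge0 (Re (f x) - Re (g x)).
  have := sqr_ge0 (Im (f x) - Im (g x)).
  nra.
Qed.

Lemma sqnZ (c : R[i]) f : sqn (c *: f : L2fun R) = ((normc c ^+ 2)%:E * sqn f)%E.
Proof.
rewrite /sqn -ge0_integralZl//; last 3 first.
- exact: measurable_normc_sqr_fun.
- by move=> x _; rewrite lee_fin sqr_ge0.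
- by rewrite lee_fin sqr_ge0.
by apply: eq_integral => x _; rewrite -EFinM ComplexField.Normc.normcM exprMn.
Qed.

Lemma sqn_eq0 f : sqn f = 0%E -> ae_eq_halfline f 0.
Proof.
move=> f0; have : (\int[mu]_(x in D) `|(normc (f x) ^+ 2)%:E|)%E = 0%E.
  by rewrite -f0; apply: eq_integral => x _; rewrite gee0_abs ?lee_fin ?sqr_ge0.
move/ae_eq_integral_abs => /(_ (@measurable_halfline R) (measurable_normc_sqr_fun f)).
apply: filterS => x fx0 Dx.
have /eqP := fx0 Dx; rewrite eqe sqrf_eq0 => /eqP.
exact: ComplexField.Normc.eq0_normc.
Qed.

Lemma L2class_ae f : ae_eq_halfline (L2class f : L2 R) f.
Proof. by apply/L2classP; rewrite L2_funK. Qed.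

Lemma L2D_ae u v : ae_eq_halfline (u + v : L2 R) (fun x => u x + v x).
Proof.
by have := L2class_ae (repr u + repr v); rewrite raddfD /= !L2_funK.
Qed.

Lemma L2Z_ae c u : ae_eq_halfline (c *: u : L2 R) (fun x => c * u x).
Proof.
by have := L2class_ae (c *: repr u); rewrite linearZ /= L2_funK.
Qed.

Lemma L2_0_ae : ae_eq_halfline (0 : L2 R) 0.
Proof. by have := L2class_ae 0; rewrite raddf0. Qed.

Lemma sqn_class f : sqn (L2class f : L2 R) = sqn f.
Proof. exact/ae_eq_sqn/L2class_ae. Qed.

Lemma sqn_L2D u v : (sqn (u + v : L2 R)%R <= 2%:E * (sqn u + sqn v))%E.
Proof.
rewrite -{1}(L2_funK u) -{1}(L2_funK v) -raddfD sqn_class.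
exact: sqnD.
Qed.

Lemma sqn_L2Z c u : sqn (c *: u : L2 R) = ((normc c ^+ 2)%:E * sqn u)%E.
Proof. by rewrite -{1}(L2_funK u) -linearZ sqn_class sqnZ. Qed.

Lemma sqn_L2_eq0 u : sqn u = 0%E -> u = 0.
Proof.
move=> u0; rewrite -(L2_funK u) -(raddf0 (@L2class R)).
by apply/L2classP; exact: sqn_eq0.
Qed.

(** The constant in [bounded_operator] may be negative, hence the squares. *)
Lemma bounded_operatorP (T : L2 R -> L2 R) : bounded_operator T <->
  exists2 C : R, 0 <= C & forall u, (sqn (T u) <= C%:E * sqn u)%E.
Proof.
have normE u : L2norm u ^+ 2 = fine (sqn u).
  by rewrite /L2norm sqr_sqrtr// fine_ge0// sqn_ge0.
have sqnE u : sqn u = (L2norm u ^+ 2)%:E by rewrite normE fineK// sqn_fin_num.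
split=> [[C TC]|[C C0 TC]].
  exists (C ^+ 2) => [|u]; first exact: sqr_ge0.
  rewrite !sqnE -EFinM lee_fin -exprMn.
  by rewrite -[leRHS]real_normK ?num_real// ler_pXn2r ?nnegrE ?sqrtr_ge0//
    (le_trans (TC u))// ler_norm.
exists (Num.sqrt C) => u.
rewrite -(@ler_pXn2r _ 2) ?nnegrE ?mulr_ge0 ?sqrtr_ge0//.
by rewrite exprMn (sqr_sqrtr C0) -lee_fin (EFinM C) -!sqnE.
Qed.

End L2Space.

(** * Integration against indicators *)

Section RealIntegrable.
Context {R : realType}.
Local Notation mu := (@lebesgue_measure R).
Local Notation D := (@halfline R).
Implicit Types (f g : R -> R).

Definition rintegrable f : Prop := mu.-integrable D (EFin \o f).

Lemma eq_rintegrable f g : {in D, f =1 g} -> rintegrable f -> rintegrable g.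
Proof. by move=> fg; apply: eq_integrable => // x /fg /= ->. Qed.

Lemma rintegrableD f g : rintegrable f -> rintegrable g ->
  rintegrable (fun x => f x + g x).
Proof. by move=> fi gi; exact: (integrableD _ fi gi). Qed.

Lemma rintegrableZ k f : rintegrable f -> rintegrable (fun x => k * f x).
Proof. by move=> fi; exact: (integrableZl _ k fi). Qed.

Lemma rintegrableB f g : rintegrable f -> rintegrable g ->
  rintegrable (fun x => f x - g x).
Proof. by move=> fi gi; exact: (integrableB _ fi gi). Qed.

Lemma rintegrable0 : rintegrable (fun=> 0).
Proof. exact: (integrable0 mu D). Qed.

Lemma le_rintegrable f g : measurable_fun D f ->
  (forall x, D x -> `|f x| <= g x) -> rintegrable g -> rintegrable f.
Proof.
move=> mf fg; apply: le_integrable => //; first exact/measurable_EFinP.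
by move=> x Dx; rewrite /= lee_fin (le_trans (fg x Dx))// ler_norm.
Qed.

End RealIntegrable.

Section ComplexIntegral.
Context {R : realType}.
Local Notation mu := (@lebesgue_measure R).
Local Notation D := (@halfline R).
Implicit Types (f g : R -> R[i]).

Definition cintegrable f : Prop :=
  rintegrable (Re \o f) /\ rintegrable (Im \o f).

Lemma eq_cintegral f g : {in D, f =1 g} -> cintegral D f = cintegral D g.
Proof. by move=> fg; congr Complex; apply: eq_Rintegral => x /fg ->. Qed.

Lemma ae_eq_cintegral f g : cmeasurable_fun D f -> cmeasurable_fun D g ->
  ae_eq_halfline f g -> cintegral D f = cintegral D g.
Proof.
move=> [mRf mIf] [mRg mIg] fg; congr Complex; congr fine;
  apply: ae_eq_integral => //; try exact/measurable_EFinP;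
  by apply: filterS fg => x fg /fg ->.
Qed.

Lemma cintegrableD f g : cintegrable f -> cintegrable g ->
  cintegrable (fun x => f x + g x).
Proof.
move=> [Rf If] [Rg Ig]; split.
  by apply: eq_rintegrable (rintegrableD Rf Rg) => x _ /=; rewrite ReD.
by apply: eq_rintegrable (rintegrableD If Ig) => x _ /=; rewrite ImD.
Qed.

Lemma cintegralD f g : cintegrable f -> cintegrable g ->
  cintegral D (fun x => f x + g x) = cintegral D f + cintegral D g.
Proof.
move=> [Rf If] [Rg Ig].
rewrite /cintegral -[RHS]/(Complex (_ + _) (_ + _)) -!RintegralD//.
by congr Complex; apply: eq_Rintegral => x _; rewrite ?ReD ?ImD.
Qed.

Lemma cintegrableZ (c : R[i]) f : cintegrable f ->
  cintegrable (fun x => c * f x).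
Proof.
move=> [Rf If]; split.
  apply: eq_rintegrable (rintegrableB (rintegrableZ (Re c) Rf)
    (rintegrableZ (Im c) If)) => x _ /=.
  by rewrite ReM.
apply: eq_rintegrable (rintegrableD (rintegrableZ (Re c) If)
  (rintegrableZ (Im c) Rf)) => x _ /=.
by rewrite ImM.
Qed.

Lemma cintegralZ (c : R[i]) f : cintegrable f ->
  cintegral D (fun x => c * f x) = c * cintegral D f.
Proof.
move=> [Rf If].
have -> : c * cintegral D f = Complex
    (Re c * (\int[mu]_(x in D) Re (f x)) - Im c * (\int[mu]_(x in D) Im (f x)))
    (Re c * (\int[mu]_(x in D) Im (f x)) + Im c * (\int[mu]_(x in D) Re (f x))).
  by case: (c).
rewrite -!RintegralZl// -RintegralB//; [|exact: rintegrableZ..].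
rewrite -RintegralD//; [|exact: rintegrableZ..].
by congr Complex; apply: eq_Rintegral => x _; rewrite ?ReM ?ImM.
Qed.

Lemma cintegrable0 : cintegrable (fun=> 0).
Proof. by split; exact: rintegrable0. Qed.

Lemma cintegral0 : cintegral D (fun=> 0) = 0.
Proof. by rewrite /cintegral /= /Rintegral integral0. Qed.

Lemma cintegrable_sum n (f : 'I_n -> R -> R[i]) :
  (forall i, cintegrable (f i)) -> cintegrable (fun x => \sum_i f i x).
Proof.
elim: n f => [|n IHn] f fi.
  by under eq_fun do rewrite big_ord0; exact: cintegrable0.
under eq_fun do rewrite big_ord_recl.
by apply: cintegrableD => //; exact: IHn.
Qed.

Lemma cintegral_sum n (f : 'I_n -> R -> R[i]) :
  (forall i, cintegrable (f i)) ->
  cintegral D (fun x => \sum_i f i x) = \sum_i cintegral D (f i).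
Proof.
elim: n f => [|n IHn] f fi.
  by under eq_fun do rewrite big_ord0; rewrite big_ord0 cintegral0.
under eq_fun do rewrite big_ord_recl.
rewrite cintegralD//; last exact: cintegrable_sum.
by rewrite IHn// big_ord_recl.
Qed.

Lemma cintegrable_cmeasurable f : cintegrable f -> cmeasurable_fun D f.
Proof.
by move=> [/integrableP[/measurable_EFinP ? _] /integrableP[/measurable_EFinP]].
Qed.

Lemma cmeasurable_funM f g : cmeasurable_fun D f -> cmeasurable_fun D g ->
  cmeasurable_fun D (fun x => f x * g x).
Proof.
move=> [fr fi] [gr gi]; split.
- apply: (eq_measurable_fun
    (fun x => Re (f x) * Re (g x) - Im (f x) * Im (g x))).
    by move=> x _ /=; rewrite ReM.
  by apply: measurable_funB; exact: measurable_funM.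
- apply: (eq_measurable_fun
    (fun x => Re (f x) * Im (g x) + Im (f x) * Re (g x))).
    by move=> x _ /=; rewrite ImM.
  by apply: measurable_funD; exact: measurable_funM.
Qed.

End ComplexIntegral.

Section IndicatorFunctional.
Context {R : realType}.
Local Notation mu := (@lebesgue_measure R).
Local Notation D := (@halfline R).
Implicit Types (A : set R) (f g : L2fun R) (u v : L2 R).

Definition finite_measurable A := measurable A /\ (mu A < +oo)%E.

Lemma finite_measurable_itv (a b : R) b0 b1 :
  finite_measurable [set` Interval (BSide b0 a) (BSide b1 b)].
Proof.
split; first exact: measurable_itv.
by rewrite lebesgue_measure_itv; case: ifP => // _; rewrite -EFinD ltry.
Qed.

Lemma Re_indic A (x : R) : Re (\1_A x : R[i]) = \1_A x.
Proof. by rewrite !indicE; case: (_ \in _). Qed.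

Lemma Im_indic A (x : R) : Im (\1_A x : R[i]) = 0.
Proof. by rewrite !indicE; case: (_ \in _). Qed.

Lemma cmeasurable_indicM A (f : R -> R[i]) : measurable A ->
  cmeasurable_fun D f -> cmeasurable_fun D (fun y => \1_A y * f y).
Proof.
move=> mA [mR mI]; split.
  apply: (eq_measurable_fun (fun y => \1_A y * Re (f y))).
    by move=> x _ /=; rewrite ReM Re_indic Im_indic mul0r subr0.
  by apply: measurable_funM => //; exact: measurable_indic.
apply: (eq_measurable_fun (fun y => \1_A y * Im (f y))).
  by move=> x _ /=; rewrite ImM Re_indic Im_indic mul0r addr0.
by apply: measurable_funM => //; exact: measurable_indic.
Qed.

Lemma rintegrable_indic A : finite_measurable A ->
  rintegrable (\1_A : R -> R).
Proof.
move=> [mA finA]; apply/integrableP; split.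
  by apply/measurable_EFinP; exact: measurable_indic.
have -> : (\int[mu]_(x in D) `|(EFin \o \1_A) x|)%E = mu (A `&` D).
  rewrite -integral_indic//; apply: eq_integral => x _.
  by rewrite /= ger0_norm.
apply: le_lt_trans finA.
by apply: le_measure; rewrite ?inE//; exact: measurableI.
Qed.

Lemma square_integrable_indic A : finite_measurable A ->
  square_integrable (\1_A : R -> R[i]).
Proof.
move=> fA; have [mA _] := fA; split.
  split; [apply: (eq_measurable_fun (\1_A : R -> R))|
          apply: (eq_measurable_fun (cst 0 : R -> R))] => //.
  - by move=> x _ /=; rewrite Re_indic.
  - by move=> x _ /=; rewrite Im_indic.
have /integrableP[_] := rintegrable_indic fA; apply: le_lt_trans.
rewrite le_eqVlt; apply/orP; left; apply/eqP; apply: eq_integral => x _ /=.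
rewrite normc_sqr Re_indic Im_indic indicE.
by case: (x \in A) => /=; rewrite ?normr0 ?normr1 !expr2 ?mulr0 ?mulr1 addr0.
Qed.

Lemma rintegrable_normc_sqr f : rintegrable (fun x => normc (f x) ^+ 2).
Proof.
have [_ finf] := L2fun_square_integrable f; apply/integrableP; split.
  exact: measurable_normc_sqr_fun.
apply: le_lt_trans finf; rewrite le_eqVlt; apply/orP; left; apply/eqP.
by apply: eq_integral => x _ /=; rewrite ger0_norm ?sqr_ge0.
Qed.

Definition L2indic A (hA : finite_measurable A) : L2fun R :=
  mkL2fun (square_integrable_indic hA).

(** Take [m = B / (a + 1)]; the denominator is positive even when [a = 0], the
    case of a set of measure zero. *)
Lemma sqr_le_of_parabola (a B G : R) : 0 <= a ->
  (forall m, 2 * m * B <= G + m ^+ 2 * a) -> B ^+ 2 <= (a + 1) * G.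
Proof.
move=> a0 mk; have := mk (B / (a + 1)).
have a1 : a + 1 != 0 by lra.
have -> : 2 * (B / (a + 1)) * B = 2 * (B ^+ 2 / (a + 1)) by field.
have : (B / (a + 1)) ^+ 2 * a <= B ^+ 2 / (a + 1).
  have -> : B ^+ 2 / (a + 1) = (B / (a + 1)) ^+ 2 * (a + 1) by field.
  by rewrite ler_wpM2l ?sqr_ge0//; lra.
move=> h1 h2; rewrite mulrC -ler_pdivrMr; last by lra.
lra.
Qed.

Section RealCauchySchwarz.
Context (A : set R) (g : R -> R).
Context (hA : finite_measurable A) (mg : measurable_fun D g)
  (g2 : rintegrable (fun x => g x ^+ 2)).

Lemma rintegrable_indicM : rintegrable (fun x => \1_A x * g x).
Proof.
have [mA _] := hA.
apply: le_rintegrable (rintegrableD (rintegrable_indic hA) g2).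
  by apply: measurable_funM => //; exact: measurable_indic.
move=> x _; rewrite indicE normrM.
have := sqr_ge0 (`|g x| - 1); have := real_normK (num_real (g x)).
by case: (x \in A) => /=; rewrite ?normr0 ?normr1; nra.
Qed.

(** Cauchy-Schwarz up to the harmless [+ 1]: integrating the pointwise bound
    [2 m 1_A g <= g^2 + m^2 1_A] gives a parabola in [m]. *)
Lemma sqr_integral_indicM :
  (\int[mu]_(x in D) (\1_A x * g x)) ^+ 2 <=
  (fine (mu A) + 1) * \int[mu]_(x in D) (g x ^+ 2).
Proof.
set B := \int[mu]_(x in D) _; set G := \int[mu]_(x in D) _.
have [mA finA] := hA; set a := fine (mu A).
have a0 : 0 <= a by rewrite fine_ge0.
have iA := rintegrable_indic hA.
have mk m : 2 * m * B <= G + m ^+ 2 * a.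
  apply: (@le_trans _ _ (G + m ^+ 2 * \int[mu]_(x in D) \1_A x)); last first.
    rewrite lerD2l ler_wpM2l ?sqr_ge0// /Rintegral integral_indic//.
    have le_mu : (mu (A `&` D) <= mu A)%E.
      by apply: le_measure; rewrite ?inE//; exact: measurableI.
    by rewrite fine_le ?ge0_fin_numE//; exact: le_lt_trans finA.
  rewrite -!RintegralZl//; last exact: rintegrable_indicM.
  rewrite -RintegralD//; last exact: rintegrableZ.
  apply: le_Rintegral => //.
  - exact/rintegrableZ/rintegrable_indicM.
  - exact/(rintegrableD g2)/rintegrableZ.
  - move=> x _; rewrite indicE; have := sqr_ge0 (g x - m).
    have := sqr_ge0 (g x); case: (x \in A) => /=; nra.
exact: sqr_le_of_parabola a0 mk.
Qed.

End RealCauchySchwarz.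

Lemma rintegrable_Re_sqr f : rintegrable (fun x => Re (f x) ^+ 2).
Proof.
have [[mR mI] finf] := L2fun_square_integrable f.
apply: (@le_rintegrable _ _ (fun x => normc (f x) ^+ 2)).
- exact: measurable_funX.
- by move=> x _; rewrite ger0_norm ?sqr_ge0// normc_sqr lerDl sqr_ge0.
- exact: rintegrable_normc_sqr.
Qed.

Lemma rintegrable_Im_sqr f : rintegrable (fun x => Im (f x) ^+ 2).
Proof.
have [[mR mI] finf] := L2fun_square_integrable f.
apply: (@le_rintegrable _ _ (fun x => normc (f x) ^+ 2)).
- exact: measurable_funX.
- by move=> x _; rewrite ger0_norm ?sqr_ge0// normc_sqr lerDr sqr_ge0.
- exact: rintegrable_normc_sqr.
Qed.

Lemma cintegrable_indicM A f : finite_measurable A ->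
  cintegrable (fun x => \1_A x * f x).
Proof.
move=> hA; have [[mR mI] _] := L2fun_square_integrable f; split.
- apply: eq_rintegrable (rintegrable_indicM hA mR (rintegrable_Re_sqr f)).
  by move=> x _ /=; rewrite ReM Re_indic Im_indic mul0r subr0.
- apply: eq_rintegrable (rintegrable_indicM hA mI (rintegrable_Im_sqr f)).
  by move=> x _ /=; rewrite ImM Re_indic Im_indic mul0r addr0.
Qed.

Definition setint A (h : R -> R[i]) : R[i] :=
  cintegral D (fun x => \1_A x * h x).

Lemma normc_setint A f : finite_measurable A ->
  ((normc (setint A f) ^+ 2)%:E <= (fine (mu A) + 1)%:E * sqn f)%E.
Proof.
move=> hA; have [[mR mI] _] := L2fun_square_integrable f.
rewrite -[sqn f]fineK ?sqn_fin_num// -EFinM lee_fin normc_sqr /=.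
have -> : fine (sqn f) = \int[mu]_(x in D) (Re (f x) ^+ 2) +
                         \int[mu]_(x in D) (Im (f x) ^+ 2).
  rewrite -RintegralD//; [|exact: rintegrable_Re_sqr|exact: rintegrable_Im_sqr].
  by apply: eq_Rintegral => x _; rewrite normc_sqr.
rewrite mulrDr lerD//.
  apply: le_trans (sqr_integral_indicM hA mR (rintegrable_Re_sqr f)).
  rewrite le_eqVlt; apply/orP; left; apply/eqP; congr (_ ^+ 2).
  by apply: eq_Rintegral => x _ /=; rewrite ReM Re_indic Im_indic mul0r subr0.
apply: le_trans (sqr_integral_indicM hA mI (rintegrable_Im_sqr f)).
rewrite le_eqVlt; apply/orP; left; apply/eqP; congr (_ ^+ 2).
by apply: eq_Rintegral => x _ /=; rewrite ImM Re_indic Im_indic mul0r addr0.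
Qed.

Lemma ae_eq_setint A f g : measurable A -> ae_eq_halfline f g ->
  setint A f = setint A g.
Proof.
move=> mA fg; have [mf _] := L2fun_square_integrable f.
have [mg _] := L2fun_square_integrable g.
apply: ae_eq_cintegral; [exact: cmeasurable_indicM|exact: cmeasurable_indicM|].
by apply: filterS fg => x fg /fg ->.
Qed.

Lemma setintZD A (c : R[i]) f g : finite_measurable A ->
  setint A (c *: f + g : L2fun R) = c * setint A f + setint A g.
Proof.
move=> hA; rewrite /setint -cintegralZ; last exact: cintegrable_indicM.
rewrite -cintegralD; last 2 first.
- exact/cintegrableZ/cintegrable_indicM.
- exact: cintegrable_indicM.
by apply: eq_cintegral => x _; rewrite mulrDr mulrCA.
Qed.

Lemma setint_L2ZD A (c : R[i]) u v : finite_measurable A ->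
  setint A (c *: u + v : L2 R) = c * setint A u + setint A v.
Proof.
move=> hA; rewrite -setintZD//; have [mA _] := hA.
rewrite (@ae_eq_setint _ _ (c *: repr u + repr v))//.
apply/L2classP; rewrite L2_funK.
by rewrite linearD linearZ /= !L2_funK.
Qed.

End IndicatorFunctional.

(** * A step kernel gives a bounded operator of finite rank *)

Section BoundedSum.
Context {R : realType}.
Implicit Types (T S : L2 R -> L2 R).

Lemma bounded_operatorD T S : bounded_operator T -> bounded_operator S ->
  bounded_operator (fun u => T u + S u).
Proof.
move=> /bounded_operatorP[C C0 TC] /bounded_operatorP[C' C'0 SC].
apply/bounded_operatorP; exists (2 * (C + C')) => [|u].
  by rewrite mulr_ge0// addr_ge0.
apply: le_trans (sqn_L2D _ _) _.
rewrite EFinM -muleA lee_pmul2l// EFinD ge0_muleDl ?lee_fin//.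
exact: leeD.
Qed.

Lemma bounded_operator_sum n (T : 'I_n -> L2 R -> L2 R) :
  (forall i, bounded_operator (T i)) -> bounded_operator (fun u => \sum_i T i u).
Proof.
elim: n T => [|n IHn] T bT.
  under eq_fun do rewrite big_ord0.
  apply/bounded_operatorP; exists 0 => // u.
  by rewrite mul0e -(scale0r u) sqn_L2Z ComplexField.Normc.normc0 expr0n mul0e.
under eq_fun do rewrite big_ord_recl.
by apply: bounded_operatorD => //; exact: IHn.
Qed.

End BoundedSum.

Section StepOperator.
Context {R : realType} {n : nat}.
Local Notation mu := (@lebesgue_measure R).
Local Notation D := (@halfline R).
Context (d : 'I_n -> R[i]) (A : 'I_n -> set R)
  (hA : forall i, finite_measurable (A i)).

Definition step_operator (u : L2 R) : L2 R :=
  \sum_i (d i * setint (A i) u) *: L2class (L2indic (hA i)).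

Lemma step_operator_is_linear : linear step_operator.
Proof.
move=> c u v; rewrite /step_operator scaler_sumr -big_split /=.
apply: eq_bigr => i _.
by rewrite setint_L2ZD// scalerA -scalerDl mulrDr mulrCA.
Qed.

HB.instance Definition _ := GRing.isLinear.Build R[i] (L2 R) (L2 R) *:%R
  step_operator step_operator_is_linear.

Lemma step_operator_in_span u :
  in_span (fun i => L2class (L2indic (hA i))) (step_operator u).
Proof. by exists (fun i => d i * setint (A i) u). Qed.

Lemma bounded_step_operator : bounded_operator step_operator.
Proof.
apply: bounded_operator_sum => i.
pose k := fine (mu (A i)) + 1; pose N := fine (sqn (L2indic (hA i))).
have k0 : 0 <= k by rewrite addr_ge0// fine_ge0.
have N0 : 0 <= N by rewrite fine_ge0// sqn_ge0.
apply/bounded_operatorP; exists (normc (d i) ^+ 2 * k * N) => [|u].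
  by apply: mulr_ge0 => //; apply: mulr_ge0 => //; exact: sqr_ge0.
have setint_le : ((normc (setint (A i) u) ^+ 2)%:E <= k%:E * sqn u)%E.
  exact: (normc_setint (repr u) (hA i)).
rewrite sqn_L2Z sqn_class -[sqn (L2indic _)]fineK ?sqn_fin_num// -/N.
move: setint_le; rewrite -[sqn u]fineK ?sqn_fin_num// -!EFinM !lee_fin.
move=> /(ler_wpM2l (mulr_ge0 (sqr_ge0 (normc (d i))) N0)).
rewrite ComplexField.Normc.normcM exprMn mulrAC => /le_trans; apply.
by rewrite mulrA (mulrAC _ N k).
Qed.

End StepOperator.

Section StepKernel.
Context {R : realType}.
Local Notation mu := (@lebesgue_measure R).
Local Notation D := (@halfline R).

(** Values of an element of [L2] are those of a representative chosen by the
    quotient, so even a finite sum is only known almost everywhere. *)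
Lemma L2sum_ae n (c : 'I_n -> R[i]) (f : 'I_n -> L2fun R) :
  ae_eq_halfline (\sum_i c i *: L2class (f i) : L2 R)
                 (fun x => \sum_i c i * f i x).
Proof.
have -> : \sum_i c i *: L2class (f i) = L2class (\sum_i c i *: f i).
  by rewrite linear_sum; apply: eq_bigr => i _; rewrite linearZ.
apply: filterS (L2class_ae (\sum_i c i *: f i)) => x h /h ->.
by elim/big_rec2: _ => // i z g _ <-.
Qed.

(** The reason why a step kernel is separable: [max(x, y) < b] holds exactly
    when [x < b] and [y < b]. *)
Lemma indic_itv_max (b x y : R) : D x -> D y ->
  \1_(`]0, b[%classic) (Num.max x y) =
  \1_(`]0, b[%classic) x * \1_(`]0, b[%classic) y :> R[i].
Proof.
rewrite !halflineE => x0 y0; rewrite !indicE !mem_setE !in_itv /=.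
have [xy|yx] := leP x y; rewrite x0 y0 -natrM mulnb /=; congr (nat_of_bool _)%:R.
  by rewrite andb_idl// => /(le_lt_trans xy).
by rewrite andb_idr// => /(lt_trans yx).
Qed.

(** For almost every fixed [x] the identity [phi = sum_i d_i 1_(0, b_i)] holds
    at [x], hence at [max(x, y)] for almost every [y], because that point is [x]
    or [y]. *)
Lemma Qop_step n (d : 'I_n -> R[i]) (b : 'I_n -> R) (phi : R -> R[i])
    (f : L2fun R) :
  let A i := `]0, b i[%classic in
  cmeasurable_fun D phi ->
  ae_eq_halfline phi (fun t => \sum_i d i * \1_(A i) t) ->
  ae_eq_halfline (Qop phi f)
                 (fun x => \sum_i (d i * setint (A i) f) * \1_(A i) x).
Proof.
move=> A [mR mI] phiE.
have hA i : finite_measurable (A i) by exact: finite_measurable_itv.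
have fi i (x : R) : cintegrable
    (fun y => d i * \1_(A i) x * (\1_(A i) y * f y)).
  exact/cintegrableZ/cintegrable_indicM.
have [mf _] := L2fun_square_integrable f.
have := phiE; apply: filterS => x phix Dx.
transitivity
  (cintegral D (fun y => \sum_i d i * \1_(A i) x * (\1_(A i) y * f y))).
  apply: ae_eq_cintegral.
  - apply: cmeasurable_funM => //.
    have mmax : measurable_fun D (Num.max x : R -> R).
      exact: (measurable_maxr (measurable_cst _) (@measurable_id _ _ _)).
    have Dmax : Num.max x @` D `<=` D.
      by move=> _ [y _ <-]; move: Dx; rewrite !halflineE lt_max => ->.
    by split; [apply: (measurable_comp _ Dmax mR)|
               apply: (measurable_comp _ Dmax mI)].
  - exact/cintegrable_cmeasurable/cintegrable_sum.
  - apply: filterS phiE => y phiy Dy.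
    have -> : phi (Num.max x y) = \sum_i d i * \1_(A i) (Num.max x y).
      by have [_|_] := leP x y; [exact: phiy|exact: phix].
    rewrite mulr_suml; apply: eq_bigr => i _.
    by rewrite indic_itv_max// !mulrA.
rewrite cintegral_sum//; apply: eq_bigr => i _.
rewrite cintegralZ; last exact: cintegrable_indicM.
by rewrite mulrAC.
Qed.

End StepKernel.

Section StepPartition.
Context {R : realType}.
Local Notation mu := (@lebesgue_measure R).
Local Notation D := (@halfline R).

(** With [t] in the [j]-th piece, the terms [i < j] vanish and the others
    telescope. The case [j = N] is the unbounded piece. *)
Lemma step_telescope N (x : nat -> R) (c : nat -> R[i]) (t : R) j :
  (forall i, (i < N)%N -> x i < x i.+1) -> (j <= N)%N ->
  x j < t -> ((j < N)%N -> t < x j.+1) ->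
  \sum_(i < N) (c i - c i.+1) * (t < x i.+1)%R%:R = c j - c N.
Proof.
move=> x_lt jN xt tx.
have x_le i k : (i <= k <= N)%N -> x i <= x k.
  move=> /andP[]; elim: k => [|k IHk]; first by rewrite leqn0 => /eqP ->.
  rewrite leq_eqVlt => /predU1P[->//|ik] kN.
  by apply: le_trans (ltW (x_lt _ kN)); apply: IHk => //; exact: ltnW.
rewrite -(big_mkord xpredT (fun i => (c i - c i.+1) * (t < x i.+1)%R%:R)).
rewrite (big_cat_nat (n := j))//= big_nat big1 ?add0r; last first.
  move=> i /andP[_ ij]; rewrite ltNge (le_trans _ (ltW xt)) ?mulr0//.
  by rewrite x_le// ij.
rewrite big_nat (eq_bigr (fun i => - (c i.+1 - c i))).
  by rewrite -big_nat sumrN telescope_sumr// opprB.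
move=> i /andP[ji iN]; rewrite opprB; have -> : t < x i.+1.
  by apply: lt_le_trans (tx (leq_ltn_trans ji iN)) _; rewrite x_le// ltnS ji.
by rewrite mulr1.
Qed.

Lemma step_locate N (x : nat -> R) (t : R) : x 0%N < t ->
  (forall i, t != x i) ->
  exists2 j, (j <= N)%N & x j < t /\ ((j < N)%N -> t < x j.+1).
Proof.
move=> x0t t_neq; elim: N => [|N [j jN [xt tx]]].
  by exists 0%N.
have [jN'|Nj] := ltnP j N.
  by exists j; [rewrite leqW|split=> // _; exact: tx].
have {Nj jN tx}jE : j = N by apply/eqP; rewrite eqn_leq jN.
have [tN|Nt] := ltP t (x N.+1); first by exists N => //; rewrite -{1}jE.
by exists N.+1 => //; split; [rewrite lt_neqAle eq_sym t_neq|rewrite ltnn].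
Qed.

Lemma ae_neq (a : R) : {ae mu, forall t, t != a}.
Proof.
have : mu.-negligible [set a].
  by apply/negligibleP; [exact: measurable_set1|exact: lebesgue_measure_set1].
by apply: negligibleS => t /= /negP; rewrite negbK => /eqP.
Qed.

(** Summation by parts: the coefficients are the jumps of the step values, the
    value beyond the last breakpoint being zero. *)
Lemma step_partition_sum (phi : R -> R[i]) N : step_partition phi N ->
  exists (d : 'I_N -> R[i]) (b : 'I_N -> R),
    ae_eq_halfline phi (fun t => \sum_i d i * \1_(`]0, b i[%classic) t).
Proof.
move=> [x [x0 x_lt x_cst x_last]].
have /choice[c phic] : forall i, exists c : R[i], (i < N)%N ->
    {ae mu, forall t, x i < t < x i.+1 -> phi t = c}.
  by move=> i; have [/x_cst[c ?]|_] := ltnP i N; [exists c|exists 0].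
pose c' i := if (i < N)%N then c i else 0.
exists (fun i => c' i - c' i.+1), (fun i => x i.+1).
have ae_pieces : {ae mu, forall t, forall i, (i < N)%N ->
    x i < t < x i.+1 -> phi t = c i}.
  apply/ae_foralln => i; have [iN|_] := ltnP i N; last by apply: aeW.
  by apply: filterS (phic i iN) => t phit _.
have /ae_foralln ae_brk : forall i, {ae mu, forall t, t != x i}.
  by move=> i; exact: ae_neq.
move: ae_pieces x_last ae_brk; apply: filterS3 => t pieces t_last t_brk.
rewrite halflineE => t0; rewrite -x0 in t0.
have [j jN [xt tx]] := step_locate N t0 t_brk.
transitivity (c' j - c' N).
  rewrite {2}/c' ltnn subr0 /c'; case: ltnP => [jN'|Nj].
    by apply: pieces => //; rewrite xt tx.
  by apply: t_last; rewrite (_ : N = j)//; apply/eqP; rewrite eqn_leq Nj.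
rewrite -(step_telescope c' x_lt jN xt tx).
apply: eq_bigr => i _; rewrite indicE mem_setE in_itv /=.
by rewrite -x0 t0.
Qed.

(** The separable form bounds the rank by [N]; the rank is smaller when two
    neighbouring pieces carry the same constant. *)
Lemma Q_rank_le_of_step (phi : R -> R[i]) N :
  cmeasurable_fun D phi -> step_partition phi N ->
  exists2 n, (n <= N)%N & Q_has_rank phi n.
Proof.
move=> mphi /step_partition_sum[d [b phiE]].
pose A i := `]0, b i[%classic.
have hA i : finite_measurable (A i) by exact: finite_measurable_itv.
have [n nN nT] := has_rank_of_span (step_operator_in_span d hA).
exists n => //; exists (step_operator d hA); split => //.
split; first exact: bounded_step_operator.
move=> f _; have := L2sum_ae (fun i => d i * setint (A i) (L2class f))
  (fun i => L2indic (hA i)).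
move: (Qop_step f mphi phiE); apply: filterS2 => x Qx Tx Dx.
rewrite Tx// Qx//; apply: eq_bigr => i _; congr (_ * _ * _).
exact: (ae_eq_setint (hA i).1 (L2class_ae f)).
Qed.

End StepPartition.

(** * Uniqueness of the extension *)

Section Density.
Context {R : realType}.
Local Notation mu := (@lebesgue_measure R).
Local Notation D := (@halfline R).
Implicit Types (f g : L2fun R).

(** Away from [0] and infinity, and where [f] is not too large. The set is cut
    down to the half-line, where alone [f] is measurable. *)
Definition trunc_set f n : set R :=
  `[n.+1%:R^-1, n.+1%:R] `&` (D `&` [set x | normc (f x) ^+ 2 <= n%:R]).

Lemma finite_trunc_set f n : finite_measurable (trunc_set f n).
Proof.
have [mI finI] : finite_measurable `[n.+1%:R^-1 : R, n.+1%:R]%classic.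
  exact: finite_measurable_itv.
have mS : measurable (D `&` [set x | normc (f x) ^+ 2 <= n%:R]).
  have [mf _] := L2fun_square_integrable f.
  rewrite [X in measurable X](_ : _ =
      D `&` (fun x => normc (f x) ^+ 2) @^-1` `]-oo, n%:R]); last first.
    by apply/seteqP; split=> x [Dx /=]; rewrite in_itv.
  exact: measurable_normc_sqr (measurable_itv _).
have mtr : measurable (trunc_set f n) := measurableI _ _ mI mS.
split=> //; apply: le_lt_trans finI; apply: le_measure; rewrite ?inE//.
by move=> x [].
Qed.

Lemma normc_indicM_le (A : set R) (z : R[i]) (x : R) :
  normc (\1_A x * z) ^+ 2 <= normc z ^+ 2.
Proof.
rewrite indicE; case: (x \in A); rewrite ?mul1r// mul0r.
by rewrite ComplexField.Normc.normc0 expr0n sqr_ge0.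
Qed.

Lemma square_integrable_trunc f n :
  square_integrable (fun x => \1_(trunc_set f n) x * f x).
Proof.
have [mf finf] := L2fun_square_integrable f.
have mt := cmeasurable_indicM (finite_trunc_set f n).1 mf.
split=> //; apply: le_lt_trans finf; apply: ge0_le_integral => //.
- by move=> x _; rewrite lee_fin sqr_ge0.
- by apply/measurable_EFinP; exact: measurable_normc_sqr.
- exact: measurable_normc_sqr_fun.
- by move=> x _; rewrite lee_fin normc_indicM_le.
Qed.

Definition trunc f n : L2fun R := mkL2fun (square_integrable_trunc f n).

Lemma truncE f n x : trunc f n x = \1_(trunc_set f n) x * f x.
Proof. by []. Qed.

Lemma sub_truncE f n x : (f - trunc f n : L2fun R) x =
  \1_(~` trunc_set f n) x * f x.
Proof.
rewrite -[LHS]/(f x - trunc f n x) truncE !indicE in_setC.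
by case: (x \in _); rewrite /= !(mul1r, mul0r) ?subrr ?subr0.
Qed.

Lemma mem_trunc_set f n x : D x ->
  x <= n%:R -> x^-1 <= n%:R -> normc (f x) ^+ 2 <= n%:R -> trunc_set f n x.
Proof.
move=> Dx xn xVn fn; have := Dx; rewrite halflineE => x0.
have le_S : n%:R <= n.+1%:R :> R by rewrite ler_nat.
split=> //=; rewrite in_itv /= (le_trans xn)// andbT.
by rewrite -[leRHS]invrK lef_pV2 ?posrE ?invr_gt0// (le_trans xVn).
Qed.

Lemma trunc_bounded f n : bounded_compactly_supported (trunc f n).
Proof.
split.
  exists n.+1%:R => x _; rewrite truncE indicE.
  have [/set_mem[_ [_ /= fn]]|_] := boolP (x \in _).
    rewrite mul1r; have := sqr_ge0 (normc (f x) - 1).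
    by rewrite -natr1; nra.
  by rewrite mul0r ComplexField.Normc.normc0.
exists `[n.+1%:R^-1, n.+1%:R]%classic; split.
- move=> x /=; rewrite halflineE in_itv /= => /andP[+ _].
  by apply: lt_le_trans; rewrite invr_gt0.
- exact: segment_compact.
- move=> x _ nKx; rewrite truncE indicE memNset ?mul0r//.
  by move=> [].
Qed.

(** Dominated convergence: at each point the truncation is eventually equal to
    [f], and the squared difference is at most [normc f ^ 2]. *)
Lemma cvg_trunc f : sqn (f - trunc f n : L2fun R) @[n --> \oo] --> 0%E.
Proof.
pose F n x : \bar R := (normc ((f - trunc f n : L2fun R) x) ^+ 2)%:E.
suff : (\int[mu]_(x in D) F n x)%E @[n --> \oo] -->
       (\int[mu]_(x in D) (cst 0%E x))%E by rewrite integral0.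
apply: (@dominated_cvg _ _ _ mu D (@measurable_halfline R) F (cst 0%E)
  (fun x => (normc (f x) ^+ 2)%:E)) => //.
- by move=> n; exact: measurable_normc_sqr_fun.
- move=> x; rewrite halflineE => x0.
  apply: cvg_near_cst.
  have le_nat (y : R) n : (Num.truncn y < n)%N -> y <= n%:R.
    move=> yn; apply: le_trans (ltW (truncnS_gt y)) _.
    by rewrite ler_nat.
  exists (maxn (Num.truncn (normc (f x) ^+ 2)).+1
    (maxn (Num.truncn x).+1 (Num.truncn x^-1).+1)) => // n /=.
  rewrite !geq_max => /and3P[/le_nat fn /le_nat xn /le_nat xVn].
  have xT : trunc_set f n x by apply: mem_trunc_set => //; rewrite halflineE.
  rewrite /F sub_truncE indicE in_setC mem_set//= mul0r.
  by rewrite ComplexField.Normc.normc0 expr0n.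
- exact: rintegrable_normc_sqr.
- move=> n x _; rewrite /F gee0_abs ?lee_fin ?sqr_ge0//.
  by rewrite sub_truncE normc_indicM_le.
Qed.

Lemma bounded_compactly_supported_dense f (e : R) : 0 < e ->
  exists2 g : L2fun R, bounded_compactly_supported g &
    (sqn (f - g : L2fun R)%R < e%:E)%E.
Proof.
move=> e0; apply: contrapT => no_g.
suff : (e%:E <= 0 :> \bar R)%E by rewrite lee_fin leNgt e0.
apply: (cvge_ge _ (cvg_trunc f)); apply: nearW => n.
rewrite leNgt; apply/negP => lte; apply: no_g.
by exists (trunc f n) => //; exact: trunc_bounded.
Qed.

(** The difference of the two extensions is bounded and vanishes on a dense
    subspace. *)
Lemma bounded_extension_uniq (phi : R -> R[i]) (T S : {linear L2 R -> L2 R}) :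
  bounded_extension phi T -> bounded_extension phi S -> T =1 S.
Proof.
move=> [bT TQ] [bS SQ] u; apply/eqP; rewrite -subr_eq0; apply/eqP.
have bS' : bounded_operator (fun v => -1 *: S v).
  move/bounded_operatorP: bS => [C C0 SC]; apply/bounded_operatorP.
  exists C => // v; rewrite sqn_L2Z normc_sqr /= oppr0 sqrrN.
  by rewrite expr1n expr0n addr0 mul1e.
have /bounded_operatorP[C C0 TSC] := bounded_operatorD bT bS'.
have TS0 (g : L2fun R) : bounded_compactly_supported g ->
    T (L2class g) = S (L2class g).
  move=> bg; rewrite -[LHS]L2_funK -[RHS]L2_funK; apply/L2classP.
  by move: (TQ g bg) (SQ g bg); apply: filterS2 => x Tx Sx Dx;
    rewrite [LHS]Tx// [RHS]Sx.
apply: sqn_L2_eq0; apply/eqP; rewrite eq_le sqn_ge0 andbT.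
apply/lee_addgt0Pr => e e0; rewrite add0e.
have e' : 0 < e / (C + 1) by rewrite divr_gt0// ltr_wpDl.
have [g bg lt_g] := bounded_compactly_supported_dense (repr u) e'.
have -> : T u - S u = T (u - L2class g) + -1 *: S (u - L2class g).
  by rewrite (linearB T) (linearB S) /= TS0// scaleN1r opprB addrA subrK.
apply: le_trans (TSC _) _.
have -> : sqn (u - L2class g : L2 R) = sqn (repr u - g : L2fun R).
  by rewrite -{1}(L2_funK u) -raddfB sqn_class.
apply: (@le_trans _ _ (C%:E * (e / (C + 1))%:E)%E).
  by rewrite lee_wpmul2l ?lee_fin// ltW.
rewrite -EFinM lee_fin mulrCA ler_piMr//; first exact: ltW.
by rewrite ler_pdivrMr ?mul1r ?lerDl// ltr_wpDl.
Qed.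

Lemma Q_has_rank_uniq (phi : R -> R[i]) m n :
  Q_has_rank phi m -> Q_has_rank phi n -> m = n.
Proof.
move=> [T [eT rT]] [S [eS rS]].
apply: has_rank_uniq rT _.
have TS : (T : L2 R -> L2 R) = S.
  exact/funext/(bounded_extension_uniq eT eS).
by rewrite TS.
Qed.

End Density.

(** * Counting oscillations by independent images *)

Section LowerBound.
Context {R : realType}.
Local Notation mu := (@lebesgue_measure R).
Local Notation D := (@halfline R).
Context (phi : R -> R[i]) (T : {linear L2 R -> L2 R})
  (T_ext : bounded_extension phi T).

(** For [x > q] the kernel [phi(max(x, y))] is [phi x] for all [y] in [[p, q]],
    and for [x < p] it is [phi y], which does not depend on [x]. The factor [k]
    is the length of [[p, q]] seen in the complex numbers. *)
Lemma extension_indic (p q : R) : 0 < p -> p < q ->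
  exists (w : L2 R) (k : R[i]), [/\ range T w, k != 0,
    {ae mu, forall x, q < x -> w x = k * phi x} &
    ae_cst_on w [set x | 0 < x < p]].
Proof.
move=> p0 pq; pose A := `[p, q]%classic : set R.
have hA : finite_measurable A by exact: finite_measurable_itv.
have fE x : L2indic hA x = \1_A x by [].
have A_bcs : bounded_compactly_supported (L2indic hA).
  split.
    exists 1 => x _; rewrite fE indicE.
    by case: (_ \in _); rewrite ?ComplexField.Normc.normc0 ?ComplexField.Normc.normc1.
  exists A; split; last by move=> x _ nAx; rewrite fE indicE memNset.
    move=> x; rewrite halflineE /A /= in_itv /= => /andP[+ _].
    exact: lt_le_trans.
  exact: segment_compact.
pose k := cintegral D (\1_A : R -> R[i]).
have iA : cintegrable (\1_A : R -> R[i]).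
  split; [apply: eq_rintegrable (rintegrable_indic hA)|
          apply: eq_rintegrable rintegrable0] => x _ /=.
    by rewrite Re_indic.
  by rewrite Im_indic.
have TA := T_ext.2 _ A_bcs.
exists (T (L2class (L2indic hA))), k; split.
- by exists (L2class (L2indic hA)).
- apply/eqP => /(congr1 (fun z : R[i] => Re z)) /=.
  have -> : \int[mu]_(y in D) Re (\1_A y : R[i]) = q - p.
    transitivity (\int[mu]_(y in D) (\1_A y : R)).
      by apply: eq_Rintegral => y _; rewrite Re_indic.
    rewrite /Rintegral integral_indic//; last exact: hA.1.
    have -> : A `&` D = A.
      apply/setIidPl => x; rewrite halflineE /A /= in_itv /= => /andP[+ _].
      exact: lt_le_trans.
    have muA : mu A = (q - p)%:E by rewrite /A lebesgue_measure_itv /= lte_fin pq.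
    exact: (congr1 fine muA).
  by move/eqP; rewrite subr_eq0 gt_eqF.
- apply: filterS TA => x Tx qx.
  rewrite Tx; last by rewrite halflineE (lt_trans _ qx)// (lt_trans p0).
  rewrite mulrC -cintegralZ//; apply: eq_cintegral => y _ /=.
  rewrite ?fE !indicE; have [/set_mem|_] := boolP (y \in A); last by rewrite /= !mulr0.
  rewrite /A /= in_itv /= => /andP[_ yq]; congr (phi _ * _).
  by have [xy|//] := leP x y; move: (le_lt_trans yq qx); rewrite ltNge xy.
- exists (cintegral D (fun y => phi y * \1_A y)).
  apply: filterS TA => x Tx /andP[x0 xp].
  rewrite Tx ?halflineE//; apply: eq_cintegral => y _ /=.
  rewrite ?fE !indicE; have [/set_mem|_] := boolP (y \in A); last by rewrite /= !mulr0.
  rewrite /A /= in_itv /= => /andP[py _]; congr (phi _ * _).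
  by have [//|yx] := leP x y; move: (lt_trans yx xp); rewrite ltNge py.
Qed.

Lemma ae_cst_on_L2sum n (w : 'I_n -> L2 R) (c : 'I_n -> R[i]) r :
  (forall i, ae_cst_on (w i) [set x | 0 < x < r]) ->
  ae_cst_on (\sum_i c i *: w i : L2 R) [set x | 0 < x < r].
Proof.
move=> w_cst; elim/big_ind: _ => [|u v [a ua] [b vb]|i _].
- exists 0; apply: filterS (@L2_0_ae R) => x zE /andP[x0 _].
  by rewrite zE// halflineE.
- exists (a + b); move: (L2D_ae u v) ua vb; apply: filterS3 => x uvE ua vb xr.
  by rewrite uvE ?ua ?vb// halflineE; case/andP: xr.
- have [a wa] := w_cst i; exists (c i * a).
  move: (L2Z_ae (c i) (w i)) wa; apply: filterS2 => x cwE wa xr.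
  by rewrite cwE ?wa// halflineE; case/andP: xr.
Qed.

(** The clause that each image is a.e. constant on [(0, a)] is what makes the
    induction work: on the first interval [(q, r)] all the images built from
    the later intervals are constant, whereas the new one is a multiple of
    [phi]. *)
Lemma oscillates_indep m a : 0 <= a -> oscillates phi m a ->
  exists w : 'I_m -> L2 R, [/\ lin_indep w, forall i, range T (w i) &
    forall i, ae_cst_on (w i) [set x | 0 < x < a]].
Proof.
elim: m a => [|m IHm] a a0 /=; first by exists (fun=> 0); split => [c _||] [].
move=> [q [r [aq qr bad osc]]].
have q0 : 0 < q by exact: le_lt_trans aq.
have r0 : 0 <= r by rewrite ltW// (lt_trans q0).
have [w [w_indep wT w_cst]] := IHm r r0 osc.
have [p ap pq] : exists2 p, a < p & p < q.
  by exists ((a + q) / 2); [exact: (midf_lt aq).1|exact: (midf_lt aq).2].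
have [v [k [vT k0 v_right v_left]]] := extension_indic (le_lt_trans a0 ap) pq.
exists (fcons v w); split.
- apply: lin_indep_fcons => // b c bvc0.
  apply: contrapT => /eqP b0; apply: bad.
  (* If [b != 0], the relation [b v + sum_i c_i w_i = 0] reads
     [b k phi + s = 0] on [(q, r)], against the choice of that interval. *)
  have [s sE] := ae_cst_on_L2sum c w_cst.
  exists (- s / (b * k)).
  have relation : {ae mu, forall x, D x ->
      b * v x + (\sum_i c i *: w i : L2 R) x = 0}.
    have := L2D_ae (b *: v) (\sum_i c i *: w i); rewrite bvc0.
    move: (L2Z_ae b v) (@L2_0_ae R); apply: filterS3 => x bvE zE sumE Dx.
    by rewrite -(bvE Dx) -(sumE Dx) (zE Dx).
  move: v_right sE relation; apply: filterS3 => x v_right sE rel /andP[qx xr].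
  have x0 : 0 < x by exact: lt_trans qx.
  move: rel; rewrite halflineE v_right// sE/= ?x0// => /(_ isT)/eqP.
  rewrite addr_eq0 => /eqP bkphi.
  by rewrite -bkphi mulrA [RHS]mulrC mulKf// mulf_neq0.
- by move=> i; rewrite /fcons; case: (unlift ord0 i).
- move=> i; rewrite /fcons; case: (unlift ord0 i) => [j|].
    apply: ae_cst_on_subset (w_cst j) => x /= /andP[-> xa] /=.
    by rewrite (lt_trans xa)// (lt_trans aq).
  apply: ae_cst_on_subset v_left => x /= /andP[-> xa] /=.
  exact: lt_trans ap.
Qed.

(** A nonzero constant is not square integrable on an unbounded interval. *)
Lemma ae_cst_on_ray_eq0 (w : L2 R) (q : R) (c : R[i]) : 0 <= q ->
  {ae mu, forall x, q < x -> w x = c} -> c = 0.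
Proof.
move=> q0 wc; apply: contrapT => /eqP c0.
have [[mR mI] fin_w] := L2fun_square_integrable (repr w).
have sub : `]q, +oo[%classic `<=` D.
  by move=> x /=; rewrite halflineE in_itv /= andbT; exact: le_lt_trans.
have mq : measurable (`]q, +oo[%classic : set R) by exact: measurable_itv.
have mw := measurable_normc_sqr_fun (repr w).
suff : (+oo <= sqn w)%E by rewrite leNgt fin_w.
apply: (@le_trans _ _ (\int[mu]_(x in `]q, +oo[) (normc (w x) ^+ 2)%:E)%E);
  last first.
  apply: ge0_subset_integral => //.
  by move=> x _; rewrite lee_fin sqr_ge0.
rewrite (_ : (\int[mu]_(x in _) _)%E =
    (\int[mu]_(x in `]q, +oo[) cst (normc c ^+ 2)%:E x)%E); last first.
  apply: ge0_ae_eq_integral => //.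
  - exact: measurable_funS mw.
  - by move=> x _; rewrite lee_fin sqr_ge0.
  - by move=> x _; rewrite lee_fin sqr_ge0.
  - by apply: filterS wc => x wc; rewrite /= in_itv /= andbT => /wc ->.
have muI : mu `]q, +oo[%classic = +oo%E by rewrite lebesgue_measure_itv /= ltry.
rewrite integral_cst// [X in (_ * X)%E]muI.
rewrite gt0_muley// lte_fin lt_neqAle sqr_ge0 andbT eq_sym sqrf_eq0.
by apply: contra c0 => /eqP/ComplexField.Normc.eq0_normc ->.
Qed.

(** An indicator placed beyond the last breakpoint shows that the constant
    value of [phi] there is zero. *)
Lemma step_le_rank n : has_rank T n ->
  exists2 M, (M <= n)%N & step_partition phi M.
Proof.
move=> rT; have [e eT] := has_rank_span rT.
have no_osc : ~ oscillates phi n.+1 0.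
  move=> /(oscillates_indep (lexx _))[w [w_indep wT _]].
  have we i : in_span e (w i) by have [u _ <-] := wT i.
  by have := indep_le_span we w_indep; rewrite ltnn.
have [M [x [Mn x0 x_lt x_cst [c x_last]]]] := partition_of_oscillates no_osc.
exists M => //; exists x; split => //.
have xM0 : 0 <= x M.
  elim: {Mn x_cst x_last} M x_lt => [|M IHM] x_lt; first by rewrite x0.
  by apply: le_trans (IHM _) (ltW (x_lt M _)) => // i iM; rewrite x_lt// leqW.
have [] := @extension_indic (x M + 1) (x M + 2); [lra|lra|].
move=> w [k [_ k0 wE _]].
suff c0 : c = 0 by rewrite -c0.
have /eqP : k * c = 0.
  apply: (@ae_cst_on_ray_eq0 w (x M + 2)); first lra.
  move: wE x_last; apply: filterS2 => t wE tE xt; rewrite wE// tE//=; lra.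
by rewrite mulf_eq0 (negPf k0) => /eqP.
Qed.

End LowerBound.

(** * Rank and number of steps *)

Theorem theorem12p2 (R : realType) (phi : R -> complex R)
    (hphi : clocally_integrable phi) :
  (Q_finite_rank phi <-> step_function phi) /\
  (step_function phi ->
     forall n : nat, Q_has_rank phi n <-> number_of_steps phi n).
Proof.
have [mphi _] := hphi.
have lower n : Q_has_rank phi n -> exists2 M, (M <= n)%N & step_partition phi M.
  by move=> [T [T_ext]]; exact: step_le_rank.
have upper N := @Q_rank_le_of_step R phi N mphi.
split.
  split; first by move=> [n /lower[M _]]; exists M.
  by move=> [N /upper[n _]]; exists n.
move=> _ n; split=> [rank_n|[part_n n_min]].
  have n_min M : step_partition phi M -> (n <= M)%N.
    by move=> /upper[m mM rank_m]; rewrite (Q_has_rank_uniq rank_n rank_m).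
  split=> //; have [M Mn part_M] := lower n rank_n.
  by rewrite (_ : n = M)//; apply/eqP; rewrite eqn_leq Mn n_min.
have [m mn rank_m] := upper n part_n.
have [M Mm /n_min nM] := lower m rank_m.
by rewrite (_ : n = m)//; apply/eqP; rewrite eqn_leq mn (leq_trans nM).
Qed.
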